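(* Let $k$ be a field with $\operatorname{char} k\neq 2$, let $\alpha,\beta\in k$, and let $L$ be a Lie algebra over $k$ with a basis $\{e_1,e_2,e_3\}$ such that $$[e_1,e_2]=e_3,\quad [e_2,e_3]=\alpha e_1,\quad [e_3,e_1]=\beta e_2 .$$ Let $r\in L\otimes L$. (I) If $r$ is strongly symmetric or $\alpha,\beta$-skew symmetric to the basis $\{e_1,e_2,e_3\}$, then $r$ is a solution of the CYBE. (II) If $\alpha\neq 0$ and $\beta\neq 0$, then $r$ is a solution of the CYBE in $L$ if and only if $r$ is strongly symmetric or $\alpha,\beta$-skew symmetric (to the basis $\{e_1,e_2,e_3\}$). (III) If $\alpha=\beta=0$, then $r$ is a solution of the CYBE in $L$ if and only if one of the following holds: (a) there are $p,s,t,u,v,x,y,z\in k$ with $p\neq 0$, $p^2=xy$, $xu=sp$, $xv=tp$, $tu=vs$ such that $$r=p(e_1\otimes e_2)+p(e_2\otimes e_1)+s(e_1\otimes e_3)+t(e_3\otimes e_1)+u(e_2\otimes e_3)+v(e_3\otimes e_2)+x(e_1\otimes e_1)+y(e_2\otimes e_2)+z(e_3\otimes e_3);$$ (b) there are $s,t,u,v,x,y,z\in k$ with $xy=xu=xv=ys=yt=0$ and $tu=vs$ such that $$r=s(e_1\otimes e_3)+t(e_3\otimes e_1)+u(e_2\otimes e_3)+v(e_3\otimes e_2)+x(e_1\otimes e_1)+y(e_2\otimes e_2)+z(e_3\otimes e_3).$$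
   Context: For a Lie algebra $L$ over $k$ and $r=\sum_i a_i\otimes b_i\in L\otimes L$, define in $L\otimes L\otimes L$: $[r^{12},r^{13}]=\sum_{i,j}[a_i,a_j]\otimes b_i\otimes b_j$, $[r^{12},r^{23}]=\sum_{i,j}a_i\otimes[b_i,a_j]\otimes b_j$, $[r^{13},r^{23}]=\sum_{i,j}a_i\otimes a_j\otimes[b_i,b_j]$. The element $r$ is a solution of the classical Yang–Baxter equation (CYBE) in $L$ if $[r^{12},r^{13}]+[r^{12},r^{23}]+[r^{13},r^{23}]=0$. Let $r=\sum_{i,j=1}^3k_{ij}(e_i\otimes e_j)$ with $k_{ij}\in k$. Then $r$ is strongly symmetric to the basis $\{e_1,e_2,e_3\}$ if $k_{ij}=k_{ji}$ and $k_{ij}k_{lm}=k_{il}k_{jm}$ for all $i,j,l,m\in\{1,2,3\}$ (this is independent of the basis). Write $k_{11}=x$, $k_{22}=y$, $k_{33}=z$, $k_{12}=p$, $k_{21}=q$, $k_{13}=s$, $k_{31}=t$, $k_{23}=u$, $k_{32}=v$. For $\alpha,\beta\in k$, $r$ is $\alpha,\beta$-skew symmetric to the basis $\{e_1,e_2,e_3\}$ if $p=-q$, $s=-t$, $u=-v$, $x=\alpha z$, $y=\beta z$ and $\alpha\beta z^2+\beta s^2+\alpha u^2+p^2=0$. *)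

(* Defs.v *)
From HB Require Import structures.
From mathcomp Require Import all_boot all_order all_algebra.

Set Implicit Arguments.
Unset Strict Implicit.
Unset Printing Implicit Defensive.

Import GRing.Theory.
Local Open Scope ring_scope.

HB.mixin Record isLieAlgebra (k : fieldType) L of Vector k L := {
  lie : L -> L -> L;
  lie_bilinear : bilinear_for *:%R *:%R lie;
  liexx : forall x, lie x x = 0;
  lie_jacobi : forall x y z,
    lie x (lie y z) + lie y (lie z x) + lie z (lie x y) = 0
}.

(* Finite-dimensional Lie algebras only: the carrier is a vectType. *)
#[short(type="lieVectType")]
HB.structure Definition LieAlgebra (k : fieldType) :=
  { L of isLieAlgebra k L & Vector k L }.

Section TensorProduct.
Variables (k : fieldType) (V W : vectType k).

(* V (x) W is modelled by the matrices of coordinates with respect to the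
   library bases vbasis {:V} and vbasis {:W}.  That this is the tensor product
   is witnessed below: *t is bilinear, pure tensors span (tensor_span),
   bilinear maps factor through it (tens_liftE), and the tensors e_i *t f_j of
   basis vectors are linearly independent for all bases (tens_basis_free). *)
Definition tensor := 'M[k]_(\dim {:V}, \dim {:W}).

HB.instance Definition _ :=
  Vector.copy tensor 'M[k]_(\dim {:V}, \dim {:W}).

Definition tens (v : V) (w : W) : tensor :=
  \matrix_(i, j) (coord (vbasis {:V}) i v * coord (vbasis {:W}) j w).

Definition tens_lift (U : lmodType k) (f : V -> W -> U) (r : tensor) : U :=
  \sum_i \sum_j r i j *: f (vbasis {:V})`_i (vbasis {:W})`_j.

Fact tens_bilinear : bilinear_for *:%R *:%R tens.
Proof.
by split=> u c x y; apply/matrixP=> i j; rewrite !mxE linearP /=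
  ?mulrDl ?mulrDr ?mulrA // [_ * c]mulrC.
Qed.

HB.instance Definition _ :=
  bilinear_isBilinear.Build k V W tensor *:%R *:%R tens tens_bilinear.

Fact tens_lift_linear (U : lmodType k) (f : V -> W -> U) : linear (@tens_lift U f).
Proof.
move=> c r s; rewrite /tens_lift scaler_sumr -big_split /=.
apply: eq_bigr => i _; rewrite scaler_sumr -big_split /=.
by apply: eq_bigr => j _; rewrite !mxE scalerDl scalerA.
Qed.

HB.instance Definition _ (U : lmodType k) (f : V -> W -> U) :=
  GRing.isLinear.Build k tensor U _ (@tens_lift U f) (@tens_lift_linear U f).

Lemma tens_liftE (U : lmodType k) (f : V -> W -> U) :
  bilinear_for *:%R *:%R f -> forall v w, tens_lift f (tens v w) = f v w.
Proof.
move=> [fl fr] v w.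
have fsuml u I (s : seq I) c (x : I -> V) :
    f (\sum_(i <- s) c i *: x i) u = \sum_(i <- s) c i *: f (x i) u.
  elim: s => [|i s IHs]; last by rewrite !big_cons fl IHs.
  by rewrite !big_nil; have := fl u (-1) 0 0; rewrite /= scaler0 addr0 scaleN1r addNr.
have fsumr u I (s : seq I) c (x : I -> W) :
    f u (\sum_(i <- s) c i *: x i) = \sum_(i <- s) c i *: f u (x i).
  elim: s => [|i s IHs]; last by rewrite !big_cons fr IHs.
  by rewrite !big_nil; have := fr u (-1) 0 0; rewrite /= scaler0 addr0 scaleN1r addNr.
rewrite [in RHS](coord_vbasis (memvf v)) [in RHS](coord_vbasis (memvf w)).
rewrite fsuml; apply: eq_bigr => i _; rewrite fsumr scaler_sumr.
by apply: eq_bigr => j _; rewrite mxE scalerA.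
Qed.

Lemma tensor_span (r : tensor) :
  exists s : seq (V * W), r = \sum_(x <- s) tens x.1 x.2.
Proof.
exists [seq (r i j *: (vbasis {:V})`_i, (vbasis {:W})`_j)
       | i <- enum 'I_(\dim {:V}), j <- enum 'I_(\dim {:W})].
rewrite big_allpairs_dep /=.
have coordb (T : vectType k) (i j : 'I_(\dim {:T})) :
    coord (vbasis {:T}) i (vbasis {:T})`_j = (i == j)%:R.
  by rewrite coord_free ?(basis_free (vbasisP _)) // eq_sym.
apply/matrixP=> a b; rewrite big_enum /= summxE (bigD1 a) //=.
rewrite [X in _ + X]big1 => [|i neq_ia].
  rewrite addr0 big_enum /= summxE (bigD1 b) //= big1 => [|j neq_jb].
    by rewrite mxE linearZ /= !coordb !eqxx !mulr1 addr0.
  by rewrite mxE !coordb [b == j]eq_sym (negPf neq_jb) mulr0.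
rewrite big_enum summxE /= big1 // => j _.
by rewrite mxE linearZ /= !coordb [a == i]eq_sym (negPf neq_ia) mulr0 mul0r.
Qed.

Lemma tens_basis_free m n (e : m.-tuple V) (f : n.-tuple W) (K : 'M[k]_(m, n)) :
  free e -> free f ->
  \sum_i \sum_j K i j *: tens (tnth e i) (tnth f j) = 0 -> K = 0.
Proof.
move=> free_e free_f K0; apply/matrixP=> a b; rewrite mxE.
pose g (v : V) (w : W) : k^o := coord e a v * coord f b w.
have g_bil : bilinear_for *:%R *:%R g.
  by split=> u c x y; rewrite /g linearP /= ?mulrDl ?mulrDr -?mulrA //
    mulrCA.
have := congr1 (tens_lift g) K0; rewrite linear0 linear_sum /=.
under eq_bigr => i _ do rewrite linear_sum /=.
under eq_bigr => i _ do
  under eq_bigr => j _ do rewrite linearZ /= tens_liftE // /g !(tnth_nth 0) !coord_free //.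
rewrite (bigD1 a) //= (bigD1 b) //= !eqxx mulr1 [_ *: 1]mulr1.
rewrite !big1 ?addr0 // => i neq_i.
  by rewrite big1 // => j _; rewrite (negPf neq_i) mul0r scaler0.
by rewrite (negPf neq_i) mulr0 scaler0.
Qed.

End TensorProduct.

Notation "v *t w" := (tens v w)
  (at level 40, left associativity) : ring_scope.

Section Lift2.
Variables (k : fieldType) (V : vectType k) (U : lmodType k).
Implicit Types F : V -> V -> V -> V -> U.

(* For r = \sum_i a_i (x) b_i and F linear in each argument, lift2 F r is
   \sum_i \sum_j F a_i b_i a_j b_j: see lift2_sum. *)
Definition lift2 F (r : tensor V V) : U :=
  tens_lift (fun a b => tens_lift (F a b) r) r.

Lemma lift2_sum F (s : seq (V * V)) :
    (forall a' b', bilinear_for *:%R *:%R (fun a b => F a b a' b')) ->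
    (forall a b, bilinear_for *:%R *:%R (F a b)) ->
  lift2 F (\sum_(x <- s) x.1 *t x.2) =
    \sum_(x <- s) \sum_(y <- s) F x.1 x.2 y.1 y.2.
Proof.
move=> F1 F2; rewrite /lift2 linear_sum /=; apply: eq_bigr => x _.
rewrite tens_liftE.
  by rewrite linear_sum; apply: eq_bigr => y _ /=; rewrite tens_liftE.
split=> u c v w; rewrite /= /tens_lift scaler_sumr -big_split /=;
  apply: eq_bigr => i _; rewrite scaler_sumr -big_split /=;
  apply: eq_bigr => j _.
  by have /= -> := (F1 _ _).1; rewrite scalerDr !scalerA mulrC.
by have /= -> := (F1 _ _).2; rewrite scalerDr !scalerA mulrC.
Qed.
End Lift2.

Section CYBE.
Variables (k : fieldType) (L : lieVectType k).
Implicit Types (r : tensor L L) (s : seq (L * L)).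

(* L (x) L (x) L is associated to the left. *)
Definition bracket12_13 r : tensor (tensor L L) L :=
  lift2 (fun a b a' b' => lie a a' *t b *t b') r.
Definition bracket12_23 r : tensor (tensor L L) L :=
  lift2 (fun a b a' b' => a *t lie b a' *t b') r.
Definition bracket13_23 r : tensor (tensor L L) L :=
  lift2 (fun a b a' b' => a *t a' *t lie b b') r.

Let tensPl (V W : vectType k) (w : W) c (x y : V) :
  (c *: x + y) *t w = c *: (x *t w) + y *t w.
Proof. exact: (tens_bilinear V W).1. Qed.
Let tensPr (V W : vectType k) (v : V) c (x y : W) :
  v *t (c *: x + y) = c *: (v *t x) + v *t y.
Proof. exact: (tens_bilinear V W).2. Qed.
Let liePl (w : L) c (x y : L) : lie (c *: x + y) w = c *: lie x w + lie y w.
Proof. exact: (@lie_bilinear k L).1. Qed.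
Let liePr (v : L) c (x y : L) : lie v (c *: x + y) = c *: lie v x + lie v y.
Proof. exact: (@lie_bilinear k L).2. Qed.
Let multP := (tensPl, tensPr, liePl, liePr).

Lemma bracket12_13E s :
  bracket12_13 (\sum_(x <- s) x.1 *t x.2) =
    \sum_(x <- s) \sum_(y <- s) lie x.1 y.1 *t x.2 *t y.2.
Proof. by apply: lift2_sum => a b; split=> u c x y /=; rewrite !multP. Qed.

Lemma bracket12_23E s :
  bracket12_23 (\sum_(x <- s) x.1 *t x.2) =
    \sum_(x <- s) \sum_(y <- s) x.1 *t lie x.2 y.1 *t y.2.
Proof. by apply: lift2_sum => a b; split=> u c x y /=; rewrite !multP. Qed.

Lemma bracket13_23E s :
  bracket13_23 (\sum_(x <- s) x.1 *t x.2) =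
    \sum_(x <- s) \sum_(y <- s) x.1 *t y.1 *t lie x.2 y.2.
Proof. by apply: lift2_sum => a b; split=> u c x y /=; rewrite !multP. Qed.

Definition CYBE_solution r : Prop :=
  bracket12_13 r + bracket12_23 r + bracket13_23 r = 0.
End CYBE.

Section Symmetry.
Variables (k : fieldType) (L : vectType k).
Implicit Types (e : 3.-tuple L) (K : 'M[k]_3) (r : tensor L L).

Definition tensor_of_coords e K : tensor L L :=
  \sum_i \sum_j K i j *: (tnth e i *t tnth e j).

(* If e is a basis, the coordinates K of r are unique (tens_basis_free). *)
Definition strongly_symmetric e r : Prop :=
  exists2 K, r = tensor_of_coords e K &
    (forall i j, K i j = K j i) /\
    (forall i j l m, K i j * K l m = K i l * K j m).

(* Indices are shifted by one: K 0 0 is k_11, and so on. *)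
Definition skew_coords (alpha beta : k) K : Prop :=
  let x := K 0 0 in let y := K 1 1 in let z := K 2 2 in
  let p := K 0 1 in let q := K 1 0 in
  let s := K 0 2 in let t := K 2 0 in
  let u := K 1 2 in let v := K 2 1 in
  [/\ p = - q, s = - t, u = - v, x = alpha * z & y = beta * z] /\
  alpha * beta * z ^+ 2 + beta * s ^+ 2 + alpha * u ^+ 2 + p ^+ 2 = 0.

Definition skew_symmetric (alpha beta : k) e r : Prop :=
  exists2 K, r = tensor_of_coords e K & skew_coords alpha beta K.
End Symmetry.

(* Main.v *)
Require Import Defs.
From HB Require Import structures.
From mathcomp Require Import all_boot all_order all_algebra.
From mathcomp Require Import ring.

Set Implicit Arguments.
Unset Strict Implicit.
Unset Printing Implicit Defensive.

Import GRing.Theory.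
Local Open Scope ring_scope.

(** Fix a basis e_1, e_2, e_3 with [e_1,e_2] = e_3, [e_2,e_3] = alpha e_1 and
[e_3,e_1] = beta e_2, and index it by Z/3. With d = (alpha, beta, 1) the three
relations become the single cyclic rule [e_i, e_(i+1)] = d_(i+2) e_(i+2), so
that the bracket of two vectors is their cross product scaled by d
(lie_cross). When r = sum K_ij e_i (x) e_j is grouped along the rows or the
columns of K, the brackets of the CYBE become such cross products, and r is a
solution iff 27 quadratic forms in the entries of K vanish:
cybe_solution_coords. The rest is about these quadratic equations, and the
cyclic indexing lets each argument be made once for i, i+1, i+2 instead of
three times.

(I) For a symmetric K of rank at most one the products in each form cancel in
pairs. If K is skew apart from a diagonal z d, the six equations with distinct
indices say, up to sign, that the quadratic form of the definition vanishes,
and the 21 others are identities.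

(II) Write sigma_ij = K_ij + K_ji. The equations with two equal indices give
sigma_ij (K_jl - K_lj) = 0 for i, j, l distinct, which makes the symmetric and
the skew part of K compete. If some sigma_ij is nonzero, then K_jl = K_lj and
K_il = K_li, and the remaining difference K_ij - K_ji squares to zero, so K is
symmetric (cybe_sym_of_sum); for symmetric K the equations give all 2x2 minors
up to a factor 2 d_i, so K has rank at most one (sym_cybe_rank1). If every
sigma_ij vanishes, K is diagonal plus skew, and a nonzero skew entry forces
the diagonal to be proportional to d; without such an entry K is diagonal,
hence symmetric, and the previous case applies again (cybe_skew_diag).

(III) For d = (0, 0, 1) the equations reduce to K_12 = K_21 and six relations
between products of two entries (cybe_heisenberg); the alternatives (a) and
(b) are K_12 != 0 and K_12 = 0. In (a) two of the six follow from the others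
since K_11 is then nonzero. *)

(** * Indices modulo three *)

Lemma I3_cases (i a : 'I_3) : [\/ a = i, a = i + 1 | a = i + 2].
Proof.
by case: i a => [[|[|[|//]]] ?] [[|[|[|//]]] ?];
  (apply: Or31; exact/val_inj) || (apply: Or32; exact/val_inj) ||
  (apply: Or33; exact/val_inj).
Qed.

(** Rewriting rules that bring the index of an entry, counted from a variable i,
back to one of i, i + 1, i + 2: for a variable i they do not hold by
computation. *)
Lemma I3D (i : 'I_3) :
  ((i + 1 + 1 = i + 2)%R * (i + 1 + 2 = i)%R
   * (i + 2 + 1 = i)%R * (i + 2 + 2 = i + 1)%R)%type.
Proof. by case: i => [[|[|[|//]]] ?]; do !split; apply: val_inj. Qed.

Lemma I3E :
  ((0 + 1 = 1 :> 'I_3)%R * (1 + 1 = 2 :> 'I_3)%R * (2 + 1 = 0 :> 'I_3)%R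
   * (0 + 2 = 2 :> 'I_3)%R * (1 + 2 = 0 :> 'I_3)%R * (2 + 2 = 1 :> 'I_3)%R)%type.
Proof. by do !split; apply: val_inj. Qed.

Lemma sum_I3 (V : nmodType) (i : 'I_3) (F : 'I_3 -> V) :
  \sum_a F a = F i + F (i + 1) + F (i + 2).
Proof.
rewrite (reindex_inj (addrI i)) /= !big_ord_recl big_ord0 !addr0 addrA.
by congr (F _ + F _ + F _); rewrite ?addr0 //; congr (i + _); exact/val_inj.
Qed.

(** * The equations on coordinates *)

Section CoordinateEquations.
Variables (k : fieldType) (d : 'I_3 -> k).
Implicit Types (K : 'M[k]_3) (i a b c : 'I_3).

(** The coefficient of e_a (x) e_b (x) e_c in the left-hand side of the CYBE;
its three lines come from [r12,r13], [r12,r23] and [r13,r23] in this order. *)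
Definition cybe_coord K a b c : k :=
    d a * (K (a + 1) b * K (a + 2) c - K (a + 2) b * K (a + 1) c)
  + d b * (K a (b + 1) * K (b + 2) c - K a (b + 2) * K (b + 1) c)
  + d c * (K a (c + 1) * K b (c + 2) - K a (c + 2) * K b (c + 1)).

Definition rank1_sym K :=
  (forall a b, K a b = K b a) /\
  (forall a b c m, K a b * K c m = K a c * K b m).

Lemma rank1_sym_cybe K : rank1_sym K -> forall a b c, cybe_coord K a b c = 0.
Proof.
move=> [symK rk1] a b c.
have swapR i j l m : K i j * K l m = K l j * K i m.
  by rewrite rk1 (symK i l) rk1.
rewrite /cybe_coord (swapR (a + 1)) (rk1 a (b + 1)) (mulrC (K a (c + 1))) (swapR b).
by rewrite !subrr !mulr0 !addr0.
Qed.

(** Enough minors for rank at most one: those with a corner on the diagonal.  If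
K_ii is nonzero then K_ii K_ab = K_ia K_ib is a factorisation of K; if the whole
diagonal is zero, K_ab^2 = K_aa K_bb kills every entry. *)
Lemma rank1_of_diag K : (forall a b, K a b = K b a) ->
  (forall i a b, K i i * K a b = K i a * K i b) -> rank1_sym K.
Proof.
move=> symK H; split=> // a b c m.
have [/existsP[i nz] | /existsPn diag0] := boolP [exists i, K i i != 0].
  apply/(mulfI nz)/(mulfI nz).
  have E x y u v : K i i * (K i i * (K x y * K u v))
      = K i x * K i y * (K i u * K i v) by rewrite -(H i x) -(H i u); ring.
  by rewrite !E; ring.
have K0 x y : K x y = 0.
  apply/eqP; rewrite -sqrf_eq0 expr2 -H mulf_eq0.
  by rewrite (negPn (diag0 x)).
by rewrite !K0.
Qed.

(** The alpha,beta-skew symmetry of coordinates, written for an arbitrary triple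
d so that no index is singled out; for d = (alpha, beta, 1), z is K_33. *)
Definition skew_diag (z : k) K :=
  [/\ forall a, K a a = z * d a, forall a b, a != b -> K a b = - K b a &
   z ^+ 2 * (d 0 * d 1 * d 2) + d 0 * K 1 2 ^+ 2 + d 1 * K 0 2 ^+ 2
     + d 2 * K 0 1 ^+ 2 = 0].

Lemma skew_diag_cybe z K : skew_diag z K -> forall a b c, cybe_coord K a b c = 0.
Proof.
move=> [Kd Ks Q] a b c.
have [K10 K20 K21] : [/\ K 1 0 = - K 0 1, K 2 0 = - K 0 2 & K 2 1 = - K 1 2].
  by split; apply: Ks.
have ord3 (i : 'I_3) : [\/ i = 0, i = 1 | i = 2].
  by have := I3_cases 0 i; rewrite !add0r.
rewrite /cybe_coord.
(* Up to sign, the value is 0 or the quadratic form of Q. *)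
by case: (ord3 a) => ->; case: (ord3 b) => ->; case: (ord3 c) => ->;
  rewrite !I3E ?Kd ?K10 ?K20 ?K21;
  first [ring | rewrite -[RHS]Q; ring | rewrite -[RHS]oppr0 -[in RHS]Q; ring].
Qed.

(** * Nondegenerate structure constants *)

Section Solutions.
Variable K : 'M[k]_3.
Hypothesis two_neq0 : 2 != 0 :> k.
Hypothesis d_neq0 : forall a, d a != 0.
Hypothesis sol : forall a b c, cybe_coord K a b c = 0.

(** These are the equations with indices (i,i,i+1), (i,i,i+2), (i+1,i,i) and
(i+2,i,i): two of the three terms have the factor d_i and combine into
K_i(i+1) + K_(i+1)i and K_i(i+2) + K_(i+2)i, the third term is zero. *)
Lemma cybe_sum_entries i :
  [/\ (K i (i + 1) + K (i + 1) i) * K (i + 2) (i + 1)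
        = (K i (i + 2) + K (i + 2) i) * K (i + 1) (i + 1),
      (K i (i + 1) + K (i + 1) i) * K (i + 2) (i + 2)
        = (K i (i + 2) + K (i + 2) i) * K (i + 1) (i + 2),
      (K i (i + 1) + K (i + 1) i) * K (i + 1) (i + 2)
        = (K i (i + 2) + K (i + 2) i) * K (i + 1) (i + 1) &
      (K i (i + 1) + K (i + 1) i) * K (i + 2) (i + 2)
        = (K i (i + 2) + K (i + 2) i) * K (i + 2) (i + 1)].
Proof.
split; apply/eqP; rewrite -subr_eq0; apply/eqP/(mulfI (d_neq0 i));
  rewrite mulr0.
- by rewrite -(sol i i (i + 1)) /cybe_coord !I3D; ring.
- by rewrite -(sol i i (i + 2)) /cybe_coord !I3D; ring.
- by rewrite -oppr0 -(sol (i + 1) i i) /cybe_coord !I3D; ring.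
- by rewrite -oppr0 -(sol (i + 2) i i) /cybe_coord !I3D; ring.
Qed.

(** In cybe_sum_entries the first and third equations have the same right-hand
side, the second and fourth the same left-hand side; subtracting within each
pair leaves the antisymmetric factor D. *)
Lemma cybe_sum_diff i (D := K (i + 1) (i + 2) - K (i + 2) (i + 1)) :
  (K i (i + 1) + K (i + 1) i) * D = 0 /\ (K i (i + 2) + K (i + 2) i) * D = 0.
Proof.
have [H1 H2 H3 H4] := cybe_sum_entries i.
by rewrite /D !mulrBr H1 H3 -H2 -H4 !subrr.
Qed.

Lemma cybe_iii i :
  K i (i + 1) * K (i + 2) i = K i (i + 2) * K (i + 1) i.
Proof.
apply/(mulfI (d_neq0 i))/eqP; rewrite -subr_eq0 -(sol i i i) /cybe_coord.
by apply/eqP; ring.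
Qed.

(** A nonzero sum K_ij + K_ji makes the two other pairs symmetric by
cybe_sum_diff.  If K_ij differed from K_ji, then every entry in the row and the
column of l = i + 2 would vanish, and K_ij^2 = K_ii K_jj = K_ij K_ji = K_ji^2
would follow from the equations with distinct indices. *)
Lemma cybe_sym_of_sum i :
  K i (i + 1) + K (i + 1) i != 0 -> forall a b, K a b = K b a.
Proof.
move=> s_neq0.
have := (cybe_sum_diff i).1 => /eqP.
rewrite mulf_eq0 (negPf s_neq0) /= subr_eq0 => /eqP eq_jl.
have := (cybe_sum_diff (i + 1)).2 => /eqP.
rewrite !I3D (addrC _ (K i _)) mulf_eq0 (negPf s_neq0) /= subr_eq0 => /eqP eq_li.
have eq_ij : K i (i + 1) = K (i + 1) i.
  apply/eqP; rewrite -subr_eq0; apply/negPn/negP => neq_ij.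
  have il0 : K i (i + 2) = 0.
    apply: (mulIf neq_ij); rewrite mul0r mulrBr -cybe_iii -eq_li; ring.
  have jl0 : K (i + 1) (i + 2) = 0.
    apply: (mulIf neq_ij); rewrite mul0r.
    by have := cybe_iii (i + 1); rewrite !I3D eq_jl => h; ring: h.
  have ll0 : K (i + 2) (i + 2) = 0.
    apply: (mulfI s_neq0); have [_ -> _ _] := cybe_sum_entries i.
    by rewrite jl0 !mulr0.
  have : d (i + 2) * (K i (i + 1) - K (i + 1) i) ^+ 2 =
      2 * cybe_coord K i (i + 1) (i + 2) - cybe_coord K i (i + 2) (i + 1)
      + cybe_coord K (i + 1) (i + 2) i.
    by rewrite /cybe_coord !I3D eq_li -eq_jl il0 jl0 ll0; ring.
  rewrite !sol mulr0 subrr addr0 => /eqP.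
  by rewrite mulf_eq0 (negPf (d_neq0 _)) sqrf_eq0 (negPf neq_ij).
have sym_i b : K i b = K b i.
  by have [->|->|->] := I3_cases i b.
have sym_j b : K (i + 1) b = K b (i + 1).
  by have [->|->|->] := I3_cases i b.
by move=> a b; have [->|->|->] := I3_cases i a; have [->|->|->] := I3_cases i b.
Qed.

(** The off-diagonal minors come from cybe_sum_entries divided by 2, and the
principal ones from the equations with distinct indices. *)
Lemma sym_cybe_rank1 : (forall a b, K a b = K b a) -> rank1_sym K.
Proof.
move=> symK; apply: rank1_of_diag => // i.
have off : K i i * K (i + 1) (i + 2) = K i (i + 1) * K i (i + 2).
  apply: (mulfI two_neq0); have [_ h _ _] := cybe_sum_entries (i + 1).
  move: h; rewrite !I3D (symK (i + 2)) (symK (i + 1) i) (symK (i + 2) i) => h.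
  transitivity ((K (i + 1) (i + 2) + K (i + 1) (i + 2)) * K i i); first by ring.
  by rewrite h; ring.
have minor0 j : K (j + 1) (j + 1) * K (j + 2) (j + 2) = K (j + 1) (j + 2) ^+ 2.
  apply/(mulfI (d_neq0 j))/(mulfI two_neq0)/eqP; rewrite -subr_eq0.
  (* The minors m_j = K_(j+1)(j+1) K_(j+2)(j+2) - K_(j+1)(j+2)^2 satisfy
     d_j m_j - d_(j+1) m_(j+1) + d_(j+2) m_(j+2) = 0 for every j; adding the
     relation for j + 1 isolates 2 d_j m_j. *)
  have -> : 2 * (d j * (K (j + 1) (j + 1) * K (j + 2) (j + 2)))
      - 2 * (d j * K (j + 1) (j + 2) ^+ 2) =
      cybe_coord K j (j + 1) (j + 2) + cybe_coord K (j + 1) (j + 2) j.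
    rewrite /cybe_coord !I3D (symK (j + 2) j) (symK (j + 1) j).
    rewrite (symK (j + 2) (j + 1)); ring.
  by rewrite !sol addr0.
have := minor0 (i + 1); have := minor0 (i + 2); rewrite !I3D => m_ij m_il.
move=> a b; have [->|->|->] := I3_cases i a; have [->|->|->] := I3_cases i b.
- by [].
- by [].
- by [].
- by rewrite mulrC symK.
- by rewrite m_ij expr2.
- exact: off.
- by rewrite mulrC symK.
- by rewrite (symK (i + 2)) off mulrC.
- by rewrite mulrC m_il (symK (i + 2)) expr2.
Qed.

(** For K diagonal plus skew, the equation with indices (a,b,a) is, up to sign,
2 K_ac (d_a K_bb - d_b K_aa) = 0 with c the third index.  So one nonzero skew
entry K_i(i+1) compares K_(i+2)(i+2) with both other diagonal entries, and the
diagonal is proportional to d. *)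
Lemma cybe_skew_diag :
  (forall i, K i (i + 1) + K (i + 1) i = 0) ->
  (forall a b, K a b = K b a) \/ exists z, skew_diag z K.
Proof.
move=> sum0.
have skew i : K (i + 1) i = - K i (i + 1).
  by apply/eqP; rewrite -addr_eq0 addrC sum0.
have skew2 i : K i (i + 2) = - K (i + 2) i.
  by have := skew (i + 2); rewrite I3D.
have skew3 i : K (i + 2) (i + 1) = - K (i + 1) (i + 2).
  by have := skew (i + 1); rewrite I3D.
have [/existsP[i nz] | /existsPn off0] := boolP [exists i, K i (i + 1) != 0].
  right.
  have ratio_il : d i * K (i + 2) (i + 2) = d (i + 2) * K i i.
    apply/(mulIf nz)/(mulfI two_neq0)/eqP; rewrite -subr_eq0.
    have -> : 2 * (d i * K (i + 2) (i + 2) * K i (i + 1))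
       - 2 * (d (i + 2) * K i i * K i (i + 1)) =
       cybe_coord K i (i + 2) i.
      rewrite /cybe_coord !I3D !(skew2, skew3, skew); ring.
    by rewrite sol.
  have ratio_jl : d (i + 1) * K (i + 2) (i + 2) = d (i + 2) * K (i + 1) (i + 1).
    apply/(mulIf nz)/(mulfI two_neq0)/eqP; rewrite -subr_eq0.
    have -> : 2 * (d (i + 1) * K (i + 2) (i + 2) * K i (i + 1))
       - 2 * (d (i + 2) * K (i + 1) (i + 1) * K i (i + 1)) =
       cybe_coord K (i + 1) (i + 2) (i + 1).
      rewrite /cybe_coord !I3D !(skew2, skew3, skew); ring.
    by rewrite sol.
  exists (K (i + 2) (i + 2) / d (i + 2)).
  have Kd a : K a a = K (i + 2) (i + 2) / d (i + 2) * d a.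
    apply: (mulIf (d_neq0 (i + 2))); rewrite mulrAC divfK // [RHS]mulrC.
    by have [->|->|->] := I3_cases i a; rewrite ?ratio_il ?ratio_jl mulrC.
  split=> [//|a b|].
    have [->|->|->] := I3_cases a b; first by rewrite eqxx.
      by rewrite skew opprK.
    by rewrite skew2.
  rewrite -(sol 0 1 2) /cybe_coord !I3E.
  have := (skew 0, skew 1, skew 2); rewrite !I3E => -[[-> ->] K02].
  by rewrite !(Kd 0, Kd 1, Kd 2) K02; ring.
left=> a b; have {}off0 i : K i (i + 1) = 0 by apply/eqP/negPn/off0.
by have [->|->|->] := I3_cases a b; rewrite // ?skew ?skew2 ?off0 ?oppr0 //;
  have := off0 (a + 2); rewrite I3D => ->; rewrite oppr0.
Qed.

Lemma cybe_rank1_or_skew : rank1_sym K \/ exists z, skew_diag z K.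
Proof.
have [/existsP[i nz] | /existsPn sum0] :=
    boolP [exists i, K i (i + 1) + K (i + 1) i != 0].
  by left; apply: sym_cybe_rank1; apply: cybe_sym_of_sum nz.
have [i|symK|] := cybe_skew_diag; [exact/eqP/negPn/sum0 | | by right].
by left; apply: sym_cybe_rank1.
Qed.

End Solutions.
End CoordinateEquations.

(** * The Heisenberg algebra *)

(** Three equations with distinct indices combine into (K_21 - K_12)^2 = 0.
After that, the relations for K_11 K_23 and K_11 K_32 occur only through their
sum and their difference, and so do those for K_22 K_13 and K_22 K_31; they are
separated on division by 2. *)
Lemma cybe_heisenberg (k : fieldType) (d : 'I_3 -> k) (K : 'M[k]_3) :
    2 != 0 :> k -> d 0 = 0 -> d 1 = 0 -> d 2 = 1 ->
  (forall a b c, cybe_coord d K a b c = 0) <->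
  K 1 0 = K 0 1 /\
  [/\ K 0 1 ^+ 2 = K 0 0 * K 1 1, K 0 0 * K 1 2 = K 0 2 * K 0 1,
      K 0 0 * K 2 1 = K 2 0 * K 0 1, K 2 0 * K 1 2 = K 2 1 * K 0 2 &
      K 1 1 * K 0 2 = K 1 2 * K 0 1 /\ K 1 1 * K 2 0 = K 2 1 * K 0 1].
Proof.
move=> two_neq0 d0 d1 d2; have cE a b c := erefl (cybe_coord d K a b c).
(* An equation that unfolds one cybe_coord and leaves the others folded. *)
rewrite {2}/cybe_coord in cE.
split=> [sol|[q_p [pp xu xv tu [ys yt]]] a b c]; last first.
  have mulC := (mulrC (K 1 1) (K 0 0), mulrC (K 1 2) (K 0 0),
    mulrC (K 2 1) (K 0 0), mulrC (K 1 2) (K 2 0), mulrC (K 0 2) (K 1 1),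
    mulrC (K 2 0) (K 1 1)).
  have := I3_cases 0; rewrite !add0r => cases0.
  by have [->|->|->] := cases0 a; have [->|->|->] := cases0 b;
    have [->|->|->] := cases0 c; rewrite cE !(I3E, d0, d1, d2) ?q_p
      ?(mulC, esym pp, xu, xv, tu, ys, yt); ring.
have q_p : K 1 0 = K 0 1.
  apply/eqP; rewrite -subr_eq0 -sqrf_eq0; apply/eqP.
  transitivity (cybe_coord d K 1 2 0 - cybe_coord d K 0 2 1
                + 2 * cybe_coord d K 0 1 2).
    by rewrite !cE !(I3E, d0, d1, d2); ring.
  by rewrite !sol; ring.
have half_eq0 (x y : k) : 2 * (x - y) = 0 -> x = y.
  by move/eqP; rewrite mulf_eq0 (negPf two_neq0) subr_eq0 => /eqP.
split=> //; split; [| | | | split].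
- apply/eqP; rewrite eq_sym -subr_eq0 -(sol 0 2 1) cE !(I3E, d0, d1, d2).
  by apply/eqP; ring.
- apply: half_eq0.
  transitivity (cybe_coord d K 0 2 2 + cybe_coord d K 2 0 2).
    by rewrite !cE !(I3E, d0, d1, d2) q_p; ring.
  by rewrite !sol addr0.
- apply: half_eq0.
  transitivity (cybe_coord d K 0 2 2 - cybe_coord d K 2 0 2).
    by rewrite !cE !(I3E, d0, d1, d2) q_p; ring.
  by rewrite !sol subr0.
- apply/eqP; rewrite -subr_eq0 -(sol 2 2 2) cE !(I3E, d0, d1, d2).
  by apply/eqP; ring.
- apply: half_eq0.
  transitivity (- cybe_coord d K 1 2 2 - cybe_coord d K 2 1 2).
    by rewrite !cE !(I3E, d0, d1, d2) q_p; ring.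
  by rewrite !sol subr0 oppr0.
- apply: half_eq0.
  transitivity (cybe_coord d K 2 1 2 - cybe_coord d K 1 2 2).
    by rewrite !cE !(I3E, d0, d1, d2) q_p; ring.
  by rewrite !sol subr0.
Qed.

(** * From tensors to coordinates *)

Section Tensors.
Variables (k : fieldType) (L : lieVectType k).

HB.instance Definition _ :=
  bilinear_isBilinear.Build k L L L *:%R *:%R (@lie k L) (@lie_bilinear k L).

Lemma lieC (x y : L) : lie x y = - lie y x.
Proof.
apply/eqP; rewrite -addr_eq0; have := liexx (x + y).
by rewrite linearDr !linearDl /= !liexx add0r addr0 addrC => ->.
Qed.

Section Structure.
Variables (e : 3.-tuple L) (d : 'I_3 -> k).
Hypothesis e_basis : basis_of {:L} e.
Hypothesis lie_e : forall i,
  lie (tnth e i) (tnth e (i + 1)) = d (i + 2) *: tnth e (i + 2).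

Lemma lie_cross (x y : 'I_3 -> k) :
  lie (\sum_i x i *: tnth e i) (\sum_i y i *: tnth e i) =
  \sum_a (d a * (x (a + 1) * y (a + 2) - x (a + 2) * y (a + 1))) *: tnth e a.
Proof.
rewrite linear_sumlz.
transitivity (\sum_i (x i * y (i + 1) * d (i + 2)) *: tnth e (i + 2)
            - \sum_i (x i * y (i + 2) * d (i + 1)) *: tnth e (i + 1)).
  rewrite -sumrB; apply: eq_bigr => i _.
  have lieZ (a b : k) (v w : L) : lie (a *: v) (b *: w) = (a * b) *: lie v w.
    by rewrite linearZl_LR linearZr_LR /= scalerA.
  rewrite linear_sumr (sum_I3 i) /= !lieZ liexx scaler0 add0r.
  rewrite lie_e (lieC (tnth e i) (tnth e (i + 2))).
  by have := lie_e (i + 2); rewrite !I3D => ->; rewrite scalerN !scalerA.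
rewrite (reindex_inj (addIr 1)) [X in _ - X](reindex_inj (addIr 2)) /= -sumrB.
apply: eq_bigr => a _; rewrite !I3D -scalerBl; congr (_ *: _); ring.
Qed.

Lemma tensor_coordsP (r : tensor L L) : exists K, r = tensor_of_coords e K.
Proof.
have [s ->] := tensor_span r; elim: s => [|[v w] s [K eqK]].
  exists 0; rewrite big_nil /tensor_of_coords big1 // => i _.
  by rewrite big1 // => j _; rewrite mxE scale0r.
exists (\matrix_(i, j) (coord e i v * coord e j w) + K).
rewrite big_cons eqK /= [in LHS](coord_basis e_basis (memvf v)).
rewrite [in LHS](coord_basis e_basis (memvf w)) /tensor_of_coords.
rewrite linear_sumlz -big_split /=; apply: eq_bigr => i _.
rewrite linear_sumr -big_split /=; apply: eq_bigr => j _.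
by rewrite linearZl_LR linearZr_LR /= !mxE scalerDl -scalerA !(tnth_nth 0).
Qed.

(** Contracting the third factor with the coordinate form of e_c reduces the
freeness of the triple tensors to that of the double ones. *)
Lemma tensor3_free (T : 'I_3 -> 'I_3 -> 'I_3 -> k) :
  \sum_a \sum_b \sum_c T a b c *: (tnth e a *t tnth e b *t tnth e c) = 0 ->
  forall a b c, T a b c = 0.
Proof.
move=> T0 a b c; have e_free := basis_free e_basis.
pose contract (w : tensor L L) (v : L) := coord e c v *: w.
have contract_bil : bilinear_for *:%R *:%R contract.
  split=> u z x y; rewrite /contract /=; first by rewrite scalerDr !scalerA mulrC.
  by rewrite linearP scalerDl scalerA.
have := congr1 (tens_lift contract) T0; rewrite linear0 linear_sum.
under eq_bigr => i _ do rewrite linear_sum /=.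
under eq_bigr => i _ do under eq_bigr => j _ do rewrite linear_sum /=.
have -> : \sum_i \sum_j \sum_l
      tens_lift contract (T i j l *: (tnth e i *t tnth e j *t tnth e l)) =
    \sum_i \sum_j (\matrix_(i, j) T i j c : 'M_3) i j *: (tnth e i *t tnth e j).
  apply: eq_bigr => i _; apply: eq_bigr => j _.
  rewrite (bigD1 c) //= big1 => [|l neq_l];
    rewrite linearZ /= tens_liftE // /contract !(tnth_nth 0) coord_free //.
    by rewrite eqxx scale1r addr0 mxE.
  by rewrite (negPf neq_l) scale0r scaler0.
by move/(tens_basis_free e_free e_free)/matrixP/(_ a b); rewrite !mxE.
Qed.

Let colv (K : 'M[k]_3) j := \sum_i K i j *: tnth e i.
Let rowv (K : 'M[k]_3) i := \sum_j K i j *: tnth e j.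

(** Grouping r by columns or by rows leaves a single sum over the basis; in each
bracket of the CYBE the factor to be bracketed is then a cross product of two
columns, of a row and a column, or of two rows. *)
Lemma coords_by_col K : tensor_of_coords e K =
  \sum_(x <- [seq (colv K j, tnth e j) | j <- enum 'I_3]) x.1 *t x.2.
Proof.
rewrite big_map big_enum /= /tensor_of_coords exchange_big /=.
apply: eq_bigr => j _; rewrite linear_sumlz; apply: eq_bigr => i _.
by rewrite linearZl_LR.
Qed.

Lemma coords_by_row K : tensor_of_coords e K =
  \sum_(x <- [seq (tnth e i, rowv K i) | i <- enum 'I_3]) x.1 *t x.2.
Proof.
rewrite big_map big_enum /= /tensor_of_coords.
apply: eq_bigr => i _; rewrite linear_sumr; apply: eq_bigr => j _.
by rewrite linearZr_LR.
Qed.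

Lemma bracket12_13_coords K : bracket12_13 (tensor_of_coords e K) =
  \sum_a \sum_b \sum_c
    (d a * (K (a + 1) b * K (a + 2) c - K (a + 2) b * K (a + 1) c))
      *: (tnth e a *t tnth e b *t tnth e c).
Proof.
rewrite coords_by_col bracket12_13E big_map big_enum /= [RHS]exchange_big /=.
apply: eq_bigr => b _; rewrite big_map big_enum /= [RHS]exchange_big /=.
apply: eq_bigr => c _; rewrite lie_cross !linear_sumlz /=.
by apply: eq_bigr => a _; rewrite !linearZl_LR.
Qed.

Lemma bracket13_23_coords K : bracket13_23 (tensor_of_coords e K) =
  \sum_a \sum_b \sum_c
    (d c * (K a (c + 1) * K b (c + 2) - K a (c + 2) * K b (c + 1)))
      *: (tnth e a *t tnth e b *t tnth e c).
Proof.
rewrite coords_by_row bracket13_23E big_map big_enum /=.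
apply: eq_bigr => a _; rewrite big_map big_enum /=.
apply: eq_bigr => b _; rewrite lie_cross !linear_sumr /=.
by apply: eq_bigr => c _; rewrite !linearZr_LR.
Qed.

Lemma bracket12_23_coords K : bracket12_23 (tensor_of_coords e K) =
  \sum_a \sum_b \sum_c
    (d b * (K a (b + 1) * K (b + 2) c - K a (b + 2) * K (b + 1) c))
      *: (tnth e a *t tnth e b *t tnth e c).
Proof.
rewrite coords_by_row bracket12_23E big_map big_enum /=.
apply: eq_bigr => a _; rewrite big_map big_enum /= [RHS]exchange_big /=.
(* Each bracket groups its two copies of r in the same way, here by rows;
   linearity in the middle factor regroups the second copy by columns. *)
transitivity (\sum_c tnth e a *t lie (rowv K a) (colv K c) *t tnth e c).
  under eq_bigr => l _ do rewrite linear_sumr /=.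
  rewrite exchange_big /=; apply: eq_bigr => c _.
  rewrite !linear_sumr linear_sumlz /=; apply: eq_bigr => l _.
  by rewrite !linearZr_LR linearZl_LR.
apply: eq_bigr => c _; rewrite lie_cross linear_sumr linear_sumlz /=.
by apply: eq_bigr => b _; rewrite linearZr_LR linearZl_LR.
Qed.

Lemma cybe_solution_coords K :
  CYBE_solution (tensor_of_coords e K) <->
  forall a b c, cybe_coord d K a b c = 0.
Proof.
rewrite /CYBE_solution bracket12_13_coords bracket12_23_coords.
rewrite bracket13_23_coords -!big_split /=.
have -> : \sum_a (\sum_b \sum_c (d a * (K (a + 1) b * K (a + 2) c
    - K (a + 2) b * K (a + 1) c)) *: (tnth e a *t tnth e b *t tnth e c)
  + \sum_b \sum_c (d b * (K a (b + 1) * K (b + 2) c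
    - K a (b + 2) * K (b + 1) c)) *: (tnth e a *t tnth e b *t tnth e c)
  + \sum_b \sum_c (d c * (K a (c + 1) * K b (c + 2)
    - K a (c + 2) * K b (c + 1))) *: (tnth e a *t tnth e b *t tnth e c))
  = \sum_a \sum_b \sum_c
      cybe_coord d K a b c *: (tnth e a *t tnth e b *t tnth e c).
  apply: eq_bigr => a _; rewrite -!big_split /=.
  apply: eq_bigr => b _; rewrite -!big_split /=.
  by apply: eq_bigr => c _; rewrite -!scalerDl.
split=> [|sol]; first exact: tensor3_free.
by do 3![rewrite big1 // => ? _]; rewrite sol scale0r.
Qed.

End Structure.

Lemma tensor_of_coordsE (e1 e2 e3 : L) (K : 'M[k]_3) :
  tensor_of_coords [tuple e1; e2; e3] K =
    K 0 1 *: (e1 *t e2) + K 1 0 *: (e2 *t e1)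
  + K 0 2 *: (e1 *t e3) + K 2 0 *: (e3 *t e1)
  + K 1 2 *: (e2 *t e3) + K 2 1 *: (e3 *t e2)
  + K 0 0 *: (e1 *t e1) + K 1 1 *: (e2 *t e2) + K 2 2 *: (e3 *t e3).
Proof.
rewrite /tensor_of_coords (sum_I3 0) !(sum_I3 0 (fun j => K _ j *: _)).
rewrite !add0r !(tnth_nth 0) /=.
by rewrite !addrA [LHS](ACl (2*4*3*7*6*8*1*5*9)).
Qed.

Lemma coords_matrix (e1 e2 e3 : L) (p q s t u v x y z : k) :
  p *: (e1 *t e2) + q *: (e2 *t e1) + s *: (e1 *t e3) + t *: (e3 *t e1)
  + u *: (e2 *t e3) + v *: (e3 *t e2)
  + x *: (e1 *t e1) + y *: (e2 *t e2) + z *: (e3 *t e3) =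
  tensor_of_coords [tuple e1; e2; e3]
    (\matrix_(i < 3, j < 3)
       (nth [::] [:: [:: x; p; s]; [:: q; y; u]; [:: t; v; z]] i)`_j).
Proof. by rewrite tensor_of_coordsE !mxE. Qed.

End Tensors.

(** * The theorem *)

Lemma skew_coordsP (k : fieldType) (alpha beta : k) (K : 'M[k]_3) :
  skew_coords alpha beta K <->
  exists z, skew_diag (fun i : 'I_3 => [:: alpha; beta; 1]`_i) z K.
Proof.
split=> [[[p s u x y] Q]|[z [Kd Ks Q]]].
  exists (K 2 2); split=> [a|a b|].
  - have := I3_cases 0 a; rewrite !add0r => -[->|->|->] /=.
    + by rewrite x mulrC.
    + by rewrite y mulrC.
    + by rewrite mulr1.
  - have := I3_cases 0 a; have := I3_cases 0 b; rewrite !add0r.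
    by move=> [->|->|->] [->|->|->]; rewrite ?eqxx // ?p ?s ?u ?opprK.
  - by rewrite /= -[RHS]Q; ring.
have Kz : K 2 2 = z by rewrite Kd mulr1.
split; last by rewrite Kz -[RHS]Q /=; ring.
by split; rewrite ?Kz ?Kd 1?mulrC //; apply: Ks.
Qed.

Theorem proposition1p4 (k : fieldType) (char_k : 2%N \notin [pchar k])
    (alpha beta : k) (L : lieVectType k) (e1 e2 e3 : L)
    (e_basis : basis_of {:L} [:: e1; e2; e3])
    (lie12 : lie e1 e2 = e3)
    (lie23 : lie e2 e3 = alpha *: e1)
    (lie31 : lie e3 e1 = beta *: e2)
    (r : tensor L L) :
  let e := [tuple e1; e2; e3] in
  [/\ (strongly_symmetric e r \/ skew_symmetric alpha beta e r) ->
        CYBE_solution r,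
      alpha != 0 -> beta != 0 ->
        (CYBE_solution r <->
         strongly_symmetric e r \/ skew_symmetric alpha beta e r)
    & alpha = 0 -> beta = 0 ->
        (CYBE_solution r <->
         (exists p s t u v x y z : k,
            [/\ p != 0, p ^+ 2 = x * y, x * u = s * p, x * v = t * p
              & t * u = v * s] /\
            r = p *: (e1 *t e2) + p *: (e2 *t e1)
              + s *: (e1 *t e3) + t *: (e3 *t e1)
              + u *: (e2 *t e3) + v *: (e3 *t e2)
              + x *: (e1 *t e1) + y *: (e2 *t e2) + z *: (e3 *t e3))
         \/
         (exists s t u v x y z : k,
            [/\ x * y = 0, x * u = 0, x * v = 0, y * s = 0 & y * t = 0] /\
            t * u = v * s /\
            r = s *: (e1 *t e3) + t *: (e3 *t e1)
              + u *: (e2 *t e3) + v *: (e3 *t e2)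
              + x *: (e1 *t e1) + y *: (e2 *t e2) + z *: (e3 *t e3)))].
Proof.
move=> e; pose d (i : 'I_3) := [:: alpha; beta; 1]`_i.
have two_neq0 : 2 != 0 :> k by move: char_k; rewrite inE.
have lie_e i : lie (tnth e i) (tnth e (i + 1)) = d (i + 2) *: tnth e (i + 2).
  have := I3_cases 0 i; rewrite !add0r => -[->|->|->];
    by rewrite !I3E ?add0r !(tnth_nth 0) /d /= ?scale1r.
have coordsE := cybe_solution_coords (e := e) e_basis lie_e.
have part1 : strongly_symmetric e r \/ skew_symmetric alpha beta e r ->
    CYBE_solution r.
  case=> -[K -> H]; apply/coordsE; first exact: rank1_sym_cybe.
  by have /skew_coordsP[z] := H; apply: skew_diag_cybe.
have [K rE] := tensor_coordsP (e := e) e_basis r.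
split=> // [a_neq0 b_neq0 | a0 b0].
  split=> [|//]; rewrite rE => /coordsE sol.
  have d_neq0 i : d i != 0.
    by have := I3_cases 0 i; rewrite !add0r => -[->|->|->]; rewrite /d //= oner_neq0.
  have [rk1|skew] := cybe_rank1_or_skew two_neq0 d_neq0 sol; first by left; exists K.
  by right; exists K => //; apply/skew_coordsP.
have heis K' : CYBE_solution (tensor_of_coords e K') <-> _ :=
  iff_trans (coordsE K') (cybe_heisenberg K' two_neq0 a0 b0 (erefl : d 2 = 1)).
split.
  rewrite rE => /heis[q_p [pp xu xv tu [ys yt]]].
  have := tensor_of_coordsE e1 e2 e3 K; rewrite -/e => KE.
  have [p0|p_neq0] := eqVneq (K 0 1) 0; [right | left].
    exists (K 0 2), (K 2 0), (K 1 2), (K 2 1), (K 0 0), (K 1 1), (K 2 2).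
    split; first by rewrite -pp xu xv ys yt p0 !mulr0 expr0n.
    by split=> //; rewrite KE q_p p0 !scale0r !add0r.
  exists (K 0 1), (K 0 2), (K 2 0), (K 1 2), (K 2 1), (K 0 0), (K 1 1), (K 2 2).
  by split=> //; rewrite KE q_p.
case=> [[p [s [t [u [v [x [y [z [[p_neq0 pp xu xv tu] ->]]]]]]]]] |
        [s [t [u [v [x [y [z [[xy xu xv ys yt] [tu ->]]]]]]]]]].
  rewrite coords_matrix; apply/heis; rewrite !mxE /=; split=> //; split=> //.
  (* The two relations that involve y follow, multiplied by x, from
     p^2 = x y. *)
  have x_neq0 : x != 0.
    by apply: contra_neq p_neq0 => x0; apply/eqP; rewrite -sqrf_eq0 pp x0 mul0r.
  split; apply: (mulfI x_neq0); rewrite mulrA -pp mulrA ?xu ?xv; ring.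
have -> : s *: (e1 *t e3) = 0 *: (e1 *t e2) + 0 *: (e2 *t e1) + s *: (e1 *t e3).
  by rewrite !scale0r !add0r.
rewrite coords_matrix; apply/heis; rewrite !mxE /= !mulr0 xy expr0n.
by split.
Qed.
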